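(* Let $n,k,b,r,s$ be nonnegative integers with $n,k,b\ge 1$ and $r\le b$. Define $$a=k b^n+s b+r,\qquad p=\frac{s^n r+k a^n}{r+k b^n},\qquad q=\frac{s^{n-1}r+k b a^{n-1}}{r+k b^n}.$$ Then $$\alpha_{\mathrm{grp}}(E_{p/q}^{\boxtimes n})\ge p.$$
   Context: Under the stated hypotheses $p$ and $q$ are positive integers (convention $0^0=1$), so that $E_{p/q}$ below is defined. For integers $p,q\ge 1$, the fraction graph $E_{p/q}$ is the graph with vertex set $\mathbb{Z}/p\mathbb{Z}$ in which two distinct vertices are adjacent if and only if their distance modulo $p$ is strictly less than $q$ (the distance modulo $p$ of $u,v$ is the minimum of $|u'-v'|$ over integer representatives). It depends on the pair $(p,q)$, not only on the rational number $p/q$. For a graph $G$, the strong power $G^{\boxtimes n}$ has vertex set $V(G)^n$, and two distinct vertices $u,v$ are adjacent iff for every coordinate $i$ either $u_i=v_i$ or $\{u_i,v_i\}\in E(G)$. $\alpha_{\mathrm{grp}}(E_{p/q}^{\boxtimes n})$ is the size of the largest independent set of $E_{p/q}^{\boxtimes n}$ that is a subgroup of $(\mathbb{Z}/p\mathbb{Z})^n$. *)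

(* Defs.v *)
From HB Require Import structures.
From mathcomp Require Import all_boot all_order all_algebra all_fingroup.
From mathcomp Require Import boolp.

Set Implicit Arguments.
Unset Strict Implicit.
Unset Printing Implicit Defensive.

Import GRing.Theory.

(* A graph is given by its adjacency relation on a finType of vertices. *)

Definition independent (V : finType) (e : rel V) (S : {set V}) : bool :=
  [forall u in S, forall v in S, ~~ e u v].

Definition strong_power (V : finType) (e : rel V) (n : nat) : rel 'rV[V]_n :=
  fun u v => (u != v) &&
    [forall i, (u ord0 i == v ord0 i) || e (u ord0 i) (v ord0 i)].

Definition moddist_pred (p : nat) (u v : int) : pred nat := fun d =>
  `[< exists x y : int,
      [/\ (x = u %[mod p])%Z, (y = v %[mod p])%Z & absz (x - y)%R = d] >].

Lemma moddist_ex (p : nat) (u v : int) : exists d, moddist_pred p u v d.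
Proof. by exists (absz (u - v)%R); apply/asboolP; exists u, v. Qed.

Definition moddist (p : nat) (u v : int) : nat := ex_minn (moddist_ex p u v).

(* The vertex type is 'I_p.-1.+1 rather than 'Z_p, because 'Z_1 has two elements;
   for p > 0 it is Z/pZ, including the trivial group for p = 1. *)
Definition fraction_graph (p q : nat) : rel 'I_p.-1.+1 :=
  fun u v => (u != v) && (moddist p u%:Z v%:Z < q).

(* {group 'rV_n} refers to the additive group structure on row vectors. *)
Definition alpha_grp (p q n : nat) : nat :=
  \max_(H : {group 'rV['I_p.-1.+1]_n}
        | independent (strong_power (@fraction_graph p q) (n := n)) H) #|H|.

(* Main.v *)
Require Import Defs.
From HB Require Import structures.
From mathcomp Require Import all_boot all_order all_algebra all_fingroup.
From mathcomp Require Import boolp.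
From mathcomp Require Import zify ring.

(** Write n = N + 1 and M = r + k b^n, so that a = M + s b.

    The subgroup is a kernel modulo p.  For a matrix C with integer entries and
    determinant p > 0, the vectors u of (Z/pZ)^n with u C = 0 form a subgroup of
    order at least p, as the Smith normal form of C shows ([card_kermod]).  So
    it is enough to find such a C for which no nonzero integer vector x with all
    coordinates below q in absolute value satisfies x C = 0 mod p
    ([independent_kermod]).

    Such a C is a quotient of two cyclic bidiagonal matrices.  Let A have
    diagonal (a, ..., a, k a), entries -s just above the diagonal, and an extra
    r s in the lower left corner; its determinant is k a^n + r s^n.  Let B be the
    same matrix for (b, 1) instead of (a, s); its determinant is M.  With
    W = diag (1, ..., 1, k) one has A = s B + M W, hence
    C = B^-1 A = s + adj(B) W is integral and has determinant p.

    Suppose that x C = p c with c integral and |x_i| < q for all i.  Clearing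
    the denominator of B^-1 gives recurrences without any adjugate
    ([check_mx_step], [check_mx_wrap]):
      a x_(i+1) = p (b c_(i+1) - c_i) + s x_i          for i < N,
      k a x_0   = p (k b c_0 + r c_N) - r s x_N.
    In terms of y_i = s x_i - p c_i they read a x_(i+1) = p b c_(i+1) + y_i and
    k a x_0 = k p b c_0 - r y_N.  Because a q = p b + s^N r, the bound
    |x_(i+1)| < q prevents c_(i+1) > 0 as soon as y_i >= s^N r.  Because
    p = s q + k a^N, the bound |x_i| < q makes y_i >= k a^N when c_i < 0, and
    where c vanishes y only shrinks by the factor s / a.  So a negative entry of
    c is never followed by a positive one, this being where r <= b enters, through
    r s <= a; and if the first nonzero entry is negative, then y_N is so large
    that the wrap-around recurrence, whose sign is opposite, violates the bound
    at that entry.  By the symmetry (x, c) -> (-x, -c), c = 0, and then x = 0. *)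

Set Implicit Arguments.
Unset Strict Implicit.
Unset Printing Implicit Defensive.

Import Order.TTheory GRing.Theory Num.Theory.

Local Open Scope ring_scope.

(** * Small solutions of a cyclic linear recurrence *)

Lemma expr_exchange (s a : int) (e N : nat) :
  0 <= s -> s <= a -> (e <= N)%N -> a ^+ e * s ^+ N <= s ^+ e * a ^+ N.
Proof.
move=> s0 sa /subnK <-; rewrite !exprD.
have le_pow : s ^+ (N - e) <= a ^+ (N - e).
  by apply: lerXn2r => //; rewrite nnegrE (le_trans s0).
rewrite [a ^+ (N - e) * _]mulrC [s ^+ (N - e) * _]mulrC !mulrA.
rewrite [s ^+ e * _]mulrC; apply: ler_wpM2l => //.
by rewrite mulr_ge0 // exprn_ge0 // (le_trans s0).
Qed.

Section SmallSolution.
Variables (N : nat) (a b k r s p q : int) (x c : nat -> int).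
Hypotheses (k_gt0 : 0 < k) (b_gt0 : 0 < b) (r_ge0 : 0 <= r) (s_ge0 : 0 <= s).
Hypotheses (a_gt0 : 0 < a) (le_sa : s <= a) (le_rsa : r * s <= a).
Hypotheses (p_gt0 : 0 < p) (pE : p = s * q + k * a ^+ N)
  (aqE : a * q = p * b + s ^+ N * r).
Hypothesis x_small : forall i, (i <= N)%N -> `|x i| < q.
Hypothesis x_step : forall i, (i < N)%N ->
  a * x i.+1 = p * (b * c i.+1 - c i) + s * x i.
Hypothesis x_wrap :
  k * a * x 0%N = p * (k * b * c 0%N + r * c N) - r * s * x N.

Let y i := s * x i - p * c i.

Lemma negative_start i : (i <= N)%N -> c i < 0 -> k * a ^+ N <= y i.
Proof.
move=> iN ci; have := x_small iN; rewrite /y => xi.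
have h1 : s * (- x i) <= s * q by apply: ler_wpM2l => //; lia.
have h2 : p * 1 <= p * (- c i) by apply: ler_wpM2l; lia.
lia.
Qed.

(** After a negative entry of c, the entries stay nonpositive: each later y is
    at least k a^N (s / a)^d, where d is the distance to the last negative
    entry, and this is at least s^N r, which keeps the next entry of c from being
    positive. *)
Lemma negative_persists i m : (i <= m <= N)%N -> c i < 0 ->
  c m <= 0 /\ exists2 d, (d <= m - i)%N & k * s ^+ d * a ^+ N <= a ^+ d * y m.
Proof.
elim: m => [|m IHm] /andP[im mN] ci.
  have -> : 0%N = i by lia.
  by split; [lia|exists 0%N; rewrite // !expr0 mulr1 mul1r negative_start //; lia].
have [eim|nim] := eqVneq i m.+1.
  rewrite -eim; split; first lia.
  by exists 0%N; rewrite // !expr0 mulr1 mul1r negative_start //; lia.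
have [|cm [d dm dP]] := IHm _ ci; first lia.
have st : a * x m.+1 = p * b * c m.+1 + y m by rewrite x_step // /y; ring.
have [cpos|cneg|c0] := ltrgt0P (c m.+1).
- exfalso.
  have h1 : p * b * 1 <= p * b * c m.+1 by apply: ler_wpM2l; nia.
  have h2 : a * x m.+1 < a * q.
    by rewrite ltr_pM2l //; have := x_small mN; lia.
  have h3 : y m < s ^+ N * r by lia.
  have h4 : a ^+ d * y m < a ^+ d * (s ^+ N * r) by rewrite ltr_pM2l // exprn_gt0.
  (* One factor s goes with r, since only r s <= a is available. *)
  have N0 : N = N.-1.+1 by lia.
  have h5 : a ^+ d * s ^+ N.-1 <= s ^+ d * a ^+ N.-1.
    by apply: expr_exchange => //; lia.
  have h6 : a ^+ d * s ^+ N.-1 * (r * s) <= s ^+ d * a ^+ N.-1 * a.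
    apply: ler_pM => //; apply: mulr_ge0 => //; apply: exprn_ge0 => //; lia.
  have h7 : 0 <= s ^+ d * a ^+ N by apply: mulr_ge0; apply: exprn_ge0; lia.
  have h8 : 1 * (s ^+ d * a ^+ N) <= k * (s ^+ d * a ^+ N).
    by apply: ler_wpM2r; lia.
  have : a ^+ d * (s ^+ N * r) = a ^+ d * s ^+ N.-1 * (r * s).
    by rewrite {1}N0 exprS; ring.
  have : s ^+ d * a ^+ N = s ^+ d * a ^+ N.-1 * a by rewrite {1}N0 exprS; ring.
  lia.
- split; first lia.
  by exists 0%N; rewrite // !expr0 mulr1 mul1r negative_start //; lia.
- split; first lia.
  exists d.+1; first lia.
  have -> : a ^+ d.+1 * y m.+1 = s * (a ^+ d * y m).
    have ay : a * y m.+1 = s * y m.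
      have -> : a * y m.+1 = s * (a * x m.+1) by rewrite {1}/y c0; ring.
      by rewrite st c0; ring.
    have -> : a ^+ d.+1 * y m.+1 = a ^+ d * (a * y m.+1) by rewrite exprS; ring.
    by rewrite ay; ring.
  have -> : k * s ^+ d.+1 * a ^+ N = s * (k * s ^+ d * a ^+ N) by rewrite exprS; ring.
  exact: ler_wpM2l.
Qed.

(** The wrap-around recurrence pushed forward through a block of zeros: as long
    as c vanishes before i, y_N contributes - (r / k) (s / a)^i y_N to a x_i. *)
Lemma wrap_unfold i : (i <= N)%N -> (forall l, (l < i)%N -> c l = 0) ->
  k * a ^+ i.+1 * x i = k * a ^+ i * p * b * c i - r * s ^+ i * y N.
Proof.
elim: i => [|i IHi] iN c0.
  by rewrite !expr1 x_wrap !expr0 /y; ring.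
have -> : k * a ^+ i.+2 * x i.+1 = k * a ^+ i.+1 * (a * x i.+1).
  by rewrite [a ^+ i.+2]exprS; ring.
rewrite x_step // (c0 i) //.
have -> : k * a ^+ i.+1 * (p * (b * c i.+1 - 0) + s * x i)
  = k * a ^+ i.+1 * p * b * c i.+1 + s * (k * a ^+ i.+1 * x i) by ring.
have IH := IHi (ltnW iN) (fun l li => c0 l (ltnW li)).
by rewrite IH (c0 i (ltnSn i)) [s ^+ i.+1]exprS; ring.
Qed.

(** If the first nonzero entry c_i were negative, [negative_persists] would
    bound y_N from below by k a^N (s / a)^d with d <= N - i, whereas
    [wrap_unfold] and |x_i| < q bound r y_N strictly from above by
    k r s^N (a / s)^i.  All inequalities are kept free of division. *)
Lemma first_nonzero_nonneg i : (i <= N)%N -> (forall l, (l < i)%N -> c l = 0) ->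
  0 <= c i.
Proof.
move=> iN c0; rewrite leNgt; apply/negP => ci.
have [|_ [d dN dP]] := @negative_persists i N _ ci; first lia.
have W := wrap_unfold iN c0.
have ai : 0 < a ^+ i by apply: exprn_gt0.
have ad : 0 < a ^+ d by apply: exprn_gt0.
have h1 : k * a ^+ i.+1 * (- q) < k * a ^+ i.+1 * x i.
  rewrite ltr_pM2l; first by have := x_small iN; lia.
  by rewrite mulr_gt0 // exprn_gt0.
have h2 : k * a ^+ i * p * b * c i <= k * a ^+ i * p * b * (-1).
  by apply: ler_wpM2l; [rewrite !mulr_ge0 //; lia|lia].
have E : k * a ^+ i.+1 * (- q) = - (k * a ^+ i * (p * b + s ^+ N * r)).
  by rewrite -aqE exprS; ring.
have h3 : r * s ^+ i * y N < k * a ^+ i * s ^+ N * r.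
  have : k * a ^+ i * (p * b + s ^+ N * r)
    = k * a ^+ i * p * b + k * a ^+ i * s ^+ N * r by ring.
  lia.
have h4 : a ^+ d * (r * s ^+ i * y N) < a ^+ d * (k * a ^+ i * s ^+ N * r).
  by rewrite ltr_pM2l.
have h5 : r * s ^+ i * (k * s ^+ d * a ^+ N) <= r * s ^+ i * (a ^+ d * y N).
  by apply: ler_wpM2l => //; rewrite mulr_ge0 // exprn_ge0.
have h6 : k * r * (a ^+ (d + i) * s ^+ N) <= k * r * (s ^+ (d + i) * a ^+ N).
  by apply: ler_wpM2l; [rewrite mulr_ge0 //; lia|apply: expr_exchange => //; lia].
have : k * r * (a ^+ (d + i) * s ^+ N) = a ^+ d * (k * a ^+ i * s ^+ N * r).
  by rewrite exprD; ring.
have : k * r * (s ^+ (d + i) * a ^+ N) = r * s ^+ i * (k * s ^+ d * a ^+ N).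
  by rewrite exprD; ring.
have : a ^+ d * (r * s ^+ i * y N) = r * s ^+ i * (a ^+ d * y N) by ring.
lia.
Qed.
End SmallSolution.

Lemma small_solution_eq0 (N : nat) (a b k r s p q : int) (x c : nat -> int) :
  0 < k -> 0 < b -> 0 <= r -> 0 <= s -> 0 < a -> s <= a -> r * s <= a ->
  0 < p -> p = s * q + k * a ^+ N ->
 a * q = p * b + s ^+ N * r ->
  (forall i, (i <= N)%N -> `|x i| < q) ->
  (forall i, (i < N)%N -> a * x i.+1 = p * (b * c i.+1 - c i) + s * x i) ->
  k * a * x 0%N = p * (k * b * c 0%N + r * c N) - r * s * x N ->
  forall i, (i <= N)%N -> c i = 0.
Proof.
move=> k0 b0 r0 s0 a0 sa rsa p0 pE qE xs xst xw i.
elim/ltn_ind: i => i IHi iN.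
have c0 l : (l < i)%N -> c l = 0 by move=> li; apply: IHi => //; lia.
apply/eqP; rewrite eq_le; apply/andP; split; last first.
  exact: (first_nonzero_nonneg k0 b0 r0 s0 a0 sa rsa p0 pE qE xs xst xw).
rewrite -oppr_ge0.
apply: (@first_nonzero_nonneg N a b k r s p q (fun i => - x i) (fun i => - c i)) => //.
- by move=> j jN; rewrite normrN; apply: xs.
- by move=> j jN; rewrite mulrN xst //; ring.
- by rewrite mulrN xw; ring.
- by move=> l li; rewrite c0 // oppr0.
Qed.

(** * Kernels of integer matrices modulo p *)

Definition mx_cong (d : int) m n (X Y : 'M[int]_(m, n)) :=
  forall i j, (d %| X i j - Y i j)%Z.

Lemma mx_cong_sym d m n (X Y : 'M[int]_(m, n)) : mx_cong d X Y -> mx_cong d Y X.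
Proof. by move=> XY i j; rewrite -opprB rpredN. Qed.

Lemma mx_cong_trans d m n (X Y Z : 'M[int]_(m, n)) :
  mx_cong d X Y -> mx_cong d Y Z -> mx_cong d X Z.
Proof.
move=> XY YZ i j.
have -> : X i j - Z i j = (X i j - Y i j) + (Y i j - Z i j) by ring.
by apply: rpredD; [apply: XY|apply: YZ].
Qed.

Lemma mx_congD d m n (X X' Y Y' : 'M[int]_(m, n)) :
  mx_cong d X X' -> mx_cong d Y Y' -> mx_cong d (X + Y) (X' + Y').
Proof.
move=> XX YY i j; rewrite !mxE.
have -> : X i j + Y i j - (X' i j + Y' i j) = (X i j - X' i j) + (Y i j - Y' i j) by ring.
by apply: rpredD; [apply: XX|apply: YY].
Qed.

Lemma mx_congB d m n (X X' Y Y' : 'M[int]_(m, n)) :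
  mx_cong d X X' -> mx_cong d Y Y' -> mx_cong d (X - Y) (X' - Y').
Proof.
move=> XX YY i j; rewrite !mxE.
have -> : X i j - Y i j - (X' i j - Y' i j) = (X i j - X' i j) - (Y i j - Y' i j) by ring.
by apply: rpredB; [apply: XX|apply: YY].
Qed.

Lemma mx_congM d m n l (X Y : 'M[int]_(m, n)) (C : 'M[int]_(n, l)) :
  mx_cong d X Y -> mx_cong d (X *m C) (Y *m C).
Proof.
move=> XY i j; rewrite !mxE -sumrB; apply: rpred_sum => t _.
by rewrite -mulrBl; apply: dvdz_mulr; apply: XY.
Qed.

Section Kernel.
Variables (p' n : nat).
Local Notation p := p'.+1.

Definition lift_row (u : 'rV['I_p]_n) : 'rV[int]_n :=
  map_mx (fun z : 'I_p => (z : nat)%:Z) u.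
Definition reduce_row (X : 'rV[int]_n) : 'rV['I_p]_n :=
  map_mx (fun m => inZp `|(m %% p)%Z|) X.

Lemma lift_rowD u v : mx_cong p (lift_row (u + v)) (lift_row u + lift_row v).
Proof.
move=> i j; rewrite !mxE /= -eqz_mod_dvd; apply/eqP.
by rewrite -modz_nat modz_mod PoszD.
Qed.

Lemma lift_row0 : mx_cong p (lift_row 0) 0.
Proof. by move=> i j; rewrite !mxE /= subrr dvdz0. Qed.

Lemma reduce_rowK X : mx_cong p (lift_row (reduce_row X)) X.
Proof.
move=> i j; rewrite !mxE /= -eqz_mod_dvd; apply/eqP.
by rewrite -modz_nat modz_mod gez0_abs ?modz_mod // modz_ge0.
Qed.

Lemma lift_row_inj u v : mx_cong p (lift_row u) (lift_row v) -> u = v.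
Proof.
move=> uv; apply/rowP => i; apply: val_inj => /=.
have := uv ord0 i; rewrite !mxE /= -eqz_mod_dvd !modz_nat => /eqP [].
by rewrite !modn_small.
Qed.

Definition kermod (C : 'M[int]_n) : {set 'rV['I_p]_n} :=
  [set u | [forall j, (p %| (lift_row u *m C) ord0 j)%Z]].

Lemma kermodP C u :
  reflect (mx_cong p (lift_row u *m C) 0) (u \in kermod C).
Proof.
rewrite inE; apply: (iffP forallP) => H.
  by move=> i j; rewrite !mxE subr0 ord1; have := H j; rewrite mxE.
by move=> j; have := H ord0 j; rewrite [X in _ - X]mxE subr0.
Qed.

Lemma kermod_group_set C : group_set (kermod C).
Proof.
apply/group_setP; split=> [|u v /kermodP uC /kermodP vC].
  rewrite FinRing.zmod1gE; apply/kermodP.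
  by rewrite -[X in mx_cong _ _ X](mul0mx _ C); apply: mx_congM; apply: lift_row0.
rewrite FinRing.zmodMgE; apply/kermodP.
apply: mx_cong_trans (mx_congM C (lift_rowD u v)) _.
by rewrite mulmxDl -[X in mx_cong _ _ X]addr0; apply: mx_congD.
Qed.

Canonical kermod_group C := Group (kermod_group_set C).

Lemma absz_det_unitmx (L : 'M[int]_n) : L \in unitmx -> absz (\det L) = 1%N.
Proof.
rewrite unitmxE => /unitrP [y [/(congr1 absz) yL _]].
by move: yL; rewrite abszM /= => /eqP; rewrite muln_eq1 => /andP[_ /eqP].
Qed.

(** With C = L D R in Smith normal form, the substitution z = u L turns u C = 0
    into the independent conditions z_i d_i = 0 mod p.  As the product of the
    |d_i| is p, each d_i divides p, and z_i may be any of the |d_i| multiples of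
    p / d_i. *)
Lemma card_kermod (C : 'M[int]_n) : absz (\det C) = p -> (p <= #|kermod C|)%N.
Proof.
have [L uL [R uR [d _ ->]]] := int_Smith_normal_form C.
set D := \matrix_(i, j) _.
have -> : \det (L *m D *m R) = \det L * (\prod_(i < n) d`_i) * \det R.
  rewrite !det_mulmx; congr (_ * _ * _).
  rewrite det_trig; first by apply: eq_bigr => i _; rewrite mxE eqxx.
  by apply/is_trig_mxP => i j ij; rewrite mxE (ltn_eqF ij).
rewrite !abszM !absz_det_unitmx // mul1n muln1 => prodE.
have abs_prod : absz (\prod_(i < n) d`_i) = (\prod_(i < n) absz (d`_i)%R)%N.
  exact: (big_morph absz abszM).
have dvd_p (i : 'I_n) : (absz (d`_i)%R %| p)%N.
  by rewrite -prodE abs_prod (bigD1 i) //= dvdn_mulr.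
have d_gt0 (i : 'I_n) : (0 < absz (d`_i)%R)%N by rewrite (dvdn_gt0 _ (dvd_p i)).
have dvdz_p (i : 'I_n) : (d`_i %| p%:Z)%Z by rewrite dvdzE.
pose F (i : 'I_n) : pred 'I_p := [pred z : 'I_p | (z < absz (d`_i)%R)%N].
pose Z (z : {ffun 'I_n -> 'I_p}) : 'rV[int]_n :=
  \row_i ((z i : nat)%:Z * (p%:Z %/ d`_i)%Z).
pose f z := reduce_row (Z z *m invmx L).
have cardF : #|family F| = p.
  rewrite card_family foldrE big_image /= -[RHS]prodE abs_prod.
  apply: eq_bigr => i _; rewrite -sum1_card.
  have := @big_ord_widen _ 0%N addn _ p (fun=> 1%N) (dvdn_leq (ltn0Sn p') (dvd_p i)).
  by rewrite /= sum1_card card_ord => ->; apply: eq_bigl.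
rewrite -{1}cardF -(card_in_imset (f := f)).
  apply: subset_leq_card; apply/subsetP => _ /imsetP [z zF ->].
  apply/kermodP; apply: mx_cong_trans (mx_congM _ (reduce_rowK _)) _.
  rewrite !mulmxA mulmxKV // -[X in mx_cong _ _ X](mul0mx _ R).
  apply: mx_congM => i j; rewrite mxE (bigD1 j) //= big1 => [|l lj].
    by rewrite addr0 !mxE eqxx mulr1n subr0 -mulrA divzK // dvdz_mull.
  by rewrite !mxE (negPf lj : (l == j :> nat) = false) mulr0n mulr0.
move=> z1 z2 z1F z2F eqf.
have : mx_cong p (Z z1) (Z z2).
  rewrite -(mulmxKV uL (Z z1)) -(mulmxKV uL (Z z2)); apply: mx_congM.
  apply: mx_cong_trans (mx_cong_sym (reduce_rowK _)) _.
  by rewrite -/(f z1) eqf; apply: reduce_rowK.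
move=> eqZ; apply/ffunP => i; apply: val_inj => /=.
have := divzK (dvdz_p i); have := eqZ ord0 i; rewrite !mxE -mulrBl.
move: (p%:Z %/ d`_i)%Z => e dvd_pe eK.
move: dvd_pe; rewrite -[X in (X %| _)%Z]eK [e * _]mulrC dvdz_mul2r; last first.
  by apply/eqP => e0; move: eK; rewrite e0 mul0r.
have z1d : (z1 i < absz (d`_i)%R)%N := familyP z1F i.
have z2d : (z2 i < absz (d`_i)%R)%N := familyP z2F i.
rewrite dvdzE => dvd_z; have [//|neq_z] := eqVneq (z1 i : nat) (z2 i : nat).
have dist_gt0 : (0 < absz ((z1 i : nat)%:Z - (z2 i : nat)%:Z))%N by lia.
have := dvdn_leq dist_gt0 dvd_z; lia.
Qed.
End Kernel.

(** * Cyclic bidiagonal matrices *)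

Section Cyclic.
Variables (N : nat) (k r : int).

(** The factor k sits on the last diagonal entry only; dividing r by k
    instead would give the same determinants up to the factor k, but not integral
    matrices. *)
Definition last_weight (i : nat) : int := if i == N then k else 1.

Definition cyc_mx (a s : int) : 'M[int]_N.+1 :=
  \matrix_(i, j) ((a * last_weight i) *+ (i == j) - s *+ (j == i.+1 :> nat)
                  + (r * s) *+ ((i == ord_max) && (j == ord0))).

Lemma row_cyc_mxS a s (w : 'rV_N.+1) i : (i < N)%N ->
  (w *m cyc_mx a s) ord0 (inord i.+1)
  = a * (last_weight i.+1 * w ord0 (inord i.+1)) - s * w ord0 (inord i).
Proof.
move=> iN; have vS : (inord i.+1 : 'I_N.+1) = i.+1 :> nat by rewrite inordK.
have vi : (inord i : 'I_N.+1) = i :> nat by rewrite inordK // ltnW.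
rewrite mxE (bigD1 (inord i.+1)) //= (bigD1 (inord i)) /=; last first.
  by rewrite -val_eqE /= vS vi; lia.
rewrite big1 => [|j /andP[j1 j2]].
  rewrite !mxE eqxx -!val_eqE /= vS vi eqxx andbF.
  have -> : (i == i.+1) = false by lia.
  have -> : (i.+1 == i.+2) = false by lia.
  by rewrite -[i.+1 == 0%N]/false andbF !mulr0n !mulr1n; ring.
move: j1 j2; rewrite !mxE -!val_eqE /= vS vi => j1 j2.
have -> : (i.+1 == j.+1) = false by rewrite eqSS eq_sym (negPf j2).
by rewrite -[i.+1 == 0%N]/false !andbF (negPf j1) !mulr0n; ring.
Qed.

Lemma row_cyc_mx0 a s (w : 'rV_N.+1) :
  (w *m cyc_mx a s) ord0 ord0
  = a * (last_weight 0 * w ord0 ord0) + r * s * w ord0 ord_max.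
Proof.
rewrite mxE.
rewrite (eq_bigr (fun j => (if j == ord0 then w ord0 j * a * last_weight j else 0)
   + (if j == ord_max then r * s * w ord0 j else 0))) => [|j _]; last first.
  rewrite mxE andbT.
  by case: (j == ord0); case: (j == ord_max); rewrite /= !(mulr0n, mulr1n); ring.
rewrite big_split /= -!big_mkcond /= !big_pred1_eq -[ord0 : nat]/0%N; ring.
Qed.

End Cyclic.

Lemma minor_cyc_mx_first N k r a s (i j : 'I_N.+1) :
  row' ord0 (col' ord0 (cyc_mx N.+1 k r a s)) i j
  = (a * last_weight N k i) *+ (i == j) - s *+ (j == i.+1 :> nat).
Proof.
rewrite !mxE -!val_eqE /= /bump !leq0n !add1n /last_weight !eqSS andbF.
by rewrite mulr0n addr0.
Qed.

Lemma minor_cyc_mx_last N k r a s (i j : 'I_N.+1) :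
  row' ord_max (col' ord0 (cyc_mx N.+1 k r a s)) i j
  = a *+ (i == j.+1 :> nat) - s *+ (i == j).
Proof.
rewrite !mxE -!val_eqE /= /bump leq0n leqNgt ltn_ord !add1n add0n.
rewrite eqSS andbF mulr0n addr0 /last_weight.
by rewrite ltn_eqF // mulr1 [j == i :> nat]eq_sym.
Qed.

(** The first column has only two nonzero entries, at its two ends; their minors
    are triangular in opposite senses. *)
Lemma det_cyc_mx N k r a s :
  \det (cyc_mx N k r a s) = k * a ^+ N.+1 + r * s ^+ N.+1.
Proof.
case: N => [|N].
  rewrite det_mx11 mxE (_ : ord_max = ord0); last exact: val_inj.
  by rewrite !eqxx !mulr1n mulr0n expr1; ring.
rewrite (expand_det_col _ ord0) (bigD1 ord0) //= (bigD1 ord_max) //= big1.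
  rewrite /cofactor addr0 -det_tr !det_trig.
  - rewrite big_ord_recr /= (eq_bigr (fun=> a)) => [|i _].
      rewrite [X in _ + _ * (_ * X)](eq_bigr (fun=> - s)) => [|i _].
        rewrite !prodr_const !card_ord [_^T _ _]mxE minor_cyc_mx_first !mxE -!val_eqE /=.
        rewrite /last_weight !eqxx [N == N.+1 :> nat]ltn_eqF //.
        have signE : (-1) ^+ N.+1 * (- s) ^+ N.+1 = s ^+ N.+1.
          by rewrite -exprMn mulN1r opprK.
        by rewrite /= !mulr0n !mulr1n !addn0 signE !exprS; ring.
      by rewrite minor_cyc_mx_last eqxx ltn_eqF // mulr0n sub0r.
    rewrite mxE minor_cyc_mx_first /last_weight /= eqxx !ltn_eqF //=.
    by rewrite mulr1 mulr1n mulr0n subr0.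
  - apply/is_trig_mxP => i j ij; rewrite minor_cyc_mx_last -val_eqE /=.
    by rewrite !ltn_eqF ?subr0 //; apply: leq_trans ij _.
  - apply/is_trig_mxP => i j ij; rewrite mxE minor_cyc_mx_first -val_eqE /=.
    by rewrite gtn_eqF // ltn_eqF ?subr0 // ltnS ltnW.
by move=> i /andP[i0 im]; rewrite mxE (negPf i0) (negPf im) /= !mulr0n; ring.
Qed.

(** * The check matrix and its kernel *)

Section Lattice.
Variables (N : nat) (k b r s : int).
Let M := r + k * b ^+ N.+1.
Let a := M + s * b.

Definition weight_mx : 'M[int]_N.+1 :=
  diag_mx (\row_(i < N.+1) last_weight N k i).
(** This is [cyc_mx b 1]^-1 *m [cyc_mx a s], written without denominators. *)
Definition check_mx : 'M[int]_N.+1 :=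
  s%:M + \adj (cyc_mx N k r b 1) *m weight_mx.

Lemma cyc_mul_check_mx : cyc_mx N k r b 1 *m check_mx = cyc_mx N k r a s.
Proof.
rewrite /check_mx mulmxDr mulmxA mul_mx_adj det_cyc_mx expr1n mulr1.
rewrite mul_scalar_mx mul_mx_scalar; apply/matrixP => i j; rewrite !mxE.
have [<-|ij] := eqVneq i j; rewrite /a /M ?mulr0n ?mulr1n; ring.
Qed.

Lemma det_check_mx (p : int) :
  M != 0 -> M * p = k * a ^+ N.+1 + r * s ^+ N.+1 -> \det check_mx = p.
Proof.
move=> M0 Mp; apply: (mulfI M0); rewrite Mp -det_cyc_mx -cyc_mul_check_mx.
rewrite det_mulmx det_cyc_mx expr1n mulr1; congr (_ * _); rewrite /M; ring.
Qed.

Section Vector.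
Variables (X c : 'rV[int]_N.+1) (p : int).
Hypothesis XC : X *m check_mx = p *: c.
Let x i := X ord0 (inord i).
Let e i := p * c ord0 (inord i) - s * x i.
Let W := X *m \adj (cyc_mx N k r b 1).

(** The equation X C = p c reads W * weight = p c - s X = e, and multiplying W by
    [cyc_mx b 1] gives back M X; eliminating W yields the two recurrences. *)
Lemma weight_WE i : (i <= N)%N -> last_weight N k i * W ord0 (inord i) = e i.
Proof.
move=> iN; have := congr1 (fun Y : 'rV_N.+1 => Y ord0 (inord i)) XC.
rewrite /weight_mx mulmxDr mulmxA mul_mx_scalar mul_mx_diag -/W !mxE inordK // => H.
rewrite /e -H /x; ring.
Qed.

Lemma W_cyc : W *m cyc_mx N k r b 1 = M *: X.
Proof.
by rewrite -mulmxA mul_adj_mx det_cyc_mx expr1n mulr1 mul_mx_scalar addrC.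
Qed.

Lemma check_mx_step i : (i < N)%N ->
  a * x i.+1 = p * (b * c ord0 (inord i.+1) - c ord0 (inord i)) + s * x i.
Proof.
move=> iN; have := congr1 (fun Y : 'rV_N.+1 => Y ord0 (inord i.+1)) W_cyc.
rewrite row_cyc_mxS // weight_WE // [RHS]mxE -/(x _).
have := @weight_WE i (ltnW iN); rewrite {1}/last_weight ltn_eqF // mul1r => ->.
move=> H.
have -> : a * x i.+1 = M * x i.+1 + s * b * x i.+1 by rewrite /a; ring.
rewrite -H /e; ring.
Qed.

Lemma check_mx_wrap :
  k * a * x 0%N
  = p * (k * b * c ord0 (inord 0) + r * c ord0 (inord N)) - r * s * x N.
Proof.
have := congr1 (fun Y : 'rV_N.+1 => Y ord0 ord0) W_cyc.
have E0 : ord0 = inord 0 :> 'I_N.+1 by apply: val_inj; rewrite /= inordK.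
have EN : ord_max = inord N :> 'I_N.+1 by apply: val_inj; rewrite /= inordK.
rewrite row_cyc_mx0 E0 weight_WE // [RHS]mxE -/(x _) EN => H.
have := @weight_WE N (leqnn N); rewrite {1}/last_weight eqxx => HN.
have -> : k * a * x 0 = k * (M * x 0) + k * s * b * x 0 by rewrite /a; ring.
rewrite -H mulrDr.
have -> : k * (r * 1 * W ord0 (inord N)) = r * (k * W ord0 (inord N)) by ring.
rewrite HN /e; ring.
Qed.
End Vector.
End Lattice.

(** The vector c with X C = p c vanishes by [small_solution_eq0], and det C = p
    is nonzero. *)
Lemma small_kernel_eq0 N (k b r s p q : int) (X : 'rV[int]_N.+1) :
  let M := r + k * b ^+ N.+1 in let a := M + s * b in
  0 < k -> 0 < b -> 0 <= r -> r <= b -> 0 <= s ->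
  0 < p -> p = s * q + k * a ^+ N -> a * q = p * b + s ^+ N * r ->
  \det (check_mx N k b r s) = p ->
  (forall i, `|X ord0 i| < q) ->
  mx_cong p (X *m check_mx N k b r s) 0 -> X = 0.
Proof.
move=> M a k0 b0 r0 rb s0 p0 pE aqE detE Xs Xc.
have M0 : 0 < M by rewrite ltr_wpDl // mulr_gt0 // exprn_gt0.
have a0 : 0 < a by rewrite /a; nia.
pose c : 'rV[int]_N.+1 := \row_j ((X *m check_mx N k b r s) ord0 j %/ p)%Z.
have XC : X *m check_mx N k b r s = p *: c.
  apply/rowP => j; rewrite [RHS]mxE [c _ _]mxE mulrC divzK //.
  by have := Xc ord0 j; rewrite [X in _ - X]mxE subr0.
have c0 : c = 0.
  apply/rowP => j; rewrite [RHS]mxE.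
  have := @small_solution_eq0 N a b k r s p q (fun i => X ord0 (inord i))
    (fun i => c ord0 (inord i)) k0 b0 r0 s0 a0.
  have sa : s <= a by rewrite /a; nia.
  have rsa : r * s <= a by rewrite /a; nia.
  move=> /(_ sa rsa p0 pE aqE).
  move=> /(_ (fun i _ => Xs _) (check_mx_step XC) (check_mx_wrap XC) j).
  by rewrite inord_val; apply; rewrite -ltnS.
have pX : p *: X = 0.
  by rewrite -detE -mul_mx_scalar -mul_mx_adj mulmxA XC c0 scaler0 mul0mx.
apply/rowP => j; have := congr1 (fun Y : 'rV_N.+1 => Y ord0 j) pX.
rewrite !mxE => /eqP; rewrite mulf_eq0 gt_eqF //= => /eqP //.
Qed.

Lemma moddist_small p q (u v : int) : (moddist p u v < q)%N ->
  exists2 t : int, `|t| < q%:Z & (p%:Z %| t - (u - v))%Z.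
Proof.
rewrite /moddist; case: ex_minnP => m /asboolP [x [y [xu yv <-]]] _ xyq.
exists (x - y); first lia.
have -> : x - y - (u - v) = (x - u) - (y - v) by ring.
by apply: rpredB; rewrite -eqz_mod_dvd; apply/eqP.
Qed.

(** Two adjacent elements of the kernel differ, modulo p, by an integer vector
    with all coordinates below q; equal coordinates contribute 0 < q. *)
Lemma independent_kermod (p' q n : nat) (C : 'M[int]_n) : (0 < q)%N ->
  (forall X : 'rV[int]_n, (forall i, `|X ord0 i| < q%:Z) ->
     mx_cong p'.+1 (X *m C) 0 -> X = 0) ->
  independent (strong_power (@fraction_graph p'.+1 q) (n := n)) (kermod p' C).
Proof.
move=> q0 small; apply/forallP => u; apply/implyP => /kermodP uC.
apply/forallP => v; apply/implyP => /kermodP vC.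
apply/negP => /andP[neq /forallP adj].
have [X Xs Xuv] : exists2 X : 'rV[int]_n, (forall i, `|X ord0 i| < q%:Z)
    & mx_cong p'.+1 X (lift_row u - lift_row v).
  have ex i : exists t : int, `|t| < q%:Z /\
      (p'.+1%:Z %| t - ((u ord0 i : nat)%:Z - (v ord0 i : nat)%:Z))%Z.
    have /orP[/eqP ->|/andP[_ /moddist_small [t]]] := adj i; last by exists t.
    by exists 0; rewrite subrr subr0 dvdz0 normr0; split.
  have [f fP] := choice ex.
  exists (\row_i f i) => [i|i j]; first by rewrite mxE; case: (fP i).
  by rewrite !mxE /= ord1; case: (fP j).
have X0 : X = 0.
  apply: small => //; apply: mx_cong_trans (mx_congM C Xuv) _.
  by rewrite mulmxBl -[X in mx_cong _ _ X](subr0 0); apply: mx_congB.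
case/negP: neq; apply/eqP/lift_row_inj => i j.
by have := Xuv i j; rewrite X0 !mxE sub0r opprB -opprB rpredN.
Qed.

(** * The parameters *)

Local Open Scope nat_scope.

Lemma expn_modl M y N : exists e, (M + y) ^ N = M * e + y ^ N.
Proof.
elim: N => [|N [e eE]]; first by exists 0; rewrite muln0.
by exists (e * (M + y) + y ^ N); rewrite !expnS eE; ring.
Qed.

(** Modulo M one has a = s b, so the numerator of q is s^N (r + k b^n) = 0; this
    gives q.  Defining p as s q + k a^N makes exact the comparison of p with s q on which
    the size estimates rest; the formula for p then follows from the one for q. *)
Lemma quotient_eq (N k b r s : nat) (M := r + k * b ^ N.+1) (a := M + s * b) :
  0 < M ->
  exists2 q, q * M = s ^ N * r + k * b * a ^ N
    & let p := s * q + k * a ^ N in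
      p * M = s ^ N.+1 * r + k * a ^ N.+1 /\ a * q = p * b + s ^ N * r.
Proof.
move=> M0; have [e eE] := expn_modl M (s * b) N.
pose q := s ^ N + k * b * e.
have qM : q * M = s ^ N * r + k * b * a ^ N.
  by rewrite /a eE expnMn /q mulnDl {1}/M expnS; ring.
exists q => //=; set p := s * q + _.
have pM : p * M = s ^ N.+1 * r + k * a ^ N.+1.
  by rewrite mulnDl -mulnA qM !expnS {3}/a; ring.
split=> //; apply/eqP; rewrite -(eqn_pmul2r M0) -mulnA qM; apply/eqP.
have -> : (p * b + s ^ N * r) * M = b * (p * M) + s ^ N * r * M by ring.
by rewrite pM !expnS; move: (a ^ N) => t; rewrite /a; ring.
Qed.

Theorem theorem1p7 (n k b r s : nat)
  (hn : 1 <= n) (hk : 1 <= k) (hb : 1 <= b) (hr : r <= b) :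
  let a := k * b ^ n + s * b + r in
  exists p q : nat,
    [/\ 0 < p, 0 < q,
        (p%:R = (s ^ n * r + k * a ^ n)%N%:R / (r + k * b ^ n)%N%:R :> rat)%R,
        (q%:R = (s ^ n.-1 * r + k * b * a ^ n.-1)%N%:R
                / (r + k * b ^ n)%N%:R :> rat)%R
      & p <= alpha_grp p q n].
Proof.
case: n hn => [//|N] _ /=.
set M := r + k * b ^ N.+1; 
have -> : k * b ^ N.+1 + s * b + r = M + s * b by rewrite /M; ring.
set a := M + s * b.
have M0 : 0 < M by rewrite addn_gt0 muln_gt0 hk expn_gt0 hb orbT.
have a0 : 0 < a by rewrite addn_gt0 M0.
have [q qM /=] := @quotient_eq N k b r s M0.
set p := s * q + k * a ^ N => -[pM aq].
have p0 : 0 < p by rewrite addn_gt0 [X in _ || X]muln_gt0 hk expn_gt0 a0 orbT.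
have q0 : 0 < q.
  by rewrite -(ltn_pmul2r M0) mul0n qM addn_gt0 !muln_gt0 hk hb !expn_gt0 a0 /= orbT.
have MQ : (M%:R != 0 :> rat)%R by rewrite pnatr_eq0 -lt0n.
exists p, q; split => //.
- by rewrite -pM natrM mulfK.
- by rewrite -qM natrM mulfK.
have [p' pp] : exists p', p = p'.+1 by exists p.-1; rewrite prednK.
have castX (x i : nat) : ((x ^ i)%:Z = x%:Z ^+ i)%R by rewrite -!natz natrX.
have castM : (M%:Z = r%:Z + k%:Z * b%:Z ^+ N.+1)%R.
  by rewrite /M PoszD PoszM castX.
have casta : (a%:Z = r%:Z + k%:Z * b%:Z ^+ N.+1 + s%:Z * b%:Z)%R.
  by rewrite /a PoszD PoszM castM.
have detE : (\det (check_mx N k b r s) = p%:Z)%R.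
  apply: det_check_mx; rewrite -castM -?casta.
    by rewrite gt_eqF // ltz_nat.
  by rewrite -!castX -!PoszM -PoszD mulnC pM addnC [r * _]mulnC.
rewrite pp.
apply: leq_trans (card_kermod (C := check_mx N k b r s) _) _.
  by rewrite detE pp.
apply: (@leq_bigmax_cond _ _ (fun H : {group 'rV['I_p'.+1]_N.+1} => #|H|)
  (kermod_group p' (check_mx N k b r s))).
apply: independent_kermod => // X Xs XC.
apply: (@small_kernel_eq0 N k b r s p q); rewrite // -?casta ?detE //.
- by rewrite -castX -!PoszM -PoszD.
- by rewrite -castX -!PoszM -PoszD aq.
- by rewrite pp.
Qed.
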